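(* Let $f\colon\mathbb{R}^n\to\mathbb{R}$ be continuously differentiable, let $M\subset\mathbb{R}^n$ be closed, and let $K\colon\mathbb{R}^n\rightrightarrows\mathbb{R}^m$ be a set-valued mapping with closed graph. Let $\bar z\in M\cap\operatorname{dom}K$ be a feasible point of $(\mathrm P)$: $\min_z\{f(z)\mid z\in M\cap\operatorname{dom}K\}$, and let $K$ be inner semicompact w.r.t. $\operatorname{dom}K$ at $\bar z$. Let $\Upsilon_{\mathrm{imp}}(z):=(z,z)-M\times\operatorname{dom}K$ for $z\in\mathbb{R}^n$. Then the following hold. (a) If $\bar z$ is abstractly M-stationary and if $\Upsilon_{\mathrm{imp}}$ is metrically subregular at $(\bar z,(0,0))$, then $\bar z$ is implicitly M-stationary. (b) If $\bar z$ is implicitly M-stationary, then there exists $\bar\lambda\in K(\bar z)$ such that $\bar z$ is explicitly M-stationary w.r.t. $\bar\lambda$. (c) $\bar z$ is explicitly M-stationary if and only if it is explicitly M-stationary w.r.t. each $\bar\lambda\in K(\bar z)$.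
   Context: $\operatorname{gph}K:=\{(z,\lambda)\mid\lambda\in K(z)\}$, $\operatorname{dom}K:=\{z\mid K(z)\neq\emptyset\}$; $\|\cdot\|$ is the Euclidean norm. For $\Omega\subset\mathbb{R}^n$ locally closed around $\bar z\in\Omega$: the regular normal cone is $\widehat N_\Omega(\bar z):=\{\zeta\mid\zeta^\top(z-\bar z)\le o(\|z-\bar z\|)\ \forall z\in\Omega\}$; the limiting normal cone $N_\Omega(\bar z)$ is the set of all $\zeta$ for which there are $z_k\to\bar z$, $z_k\in\Omega$, and $\zeta_k\to\zeta$ with $\zeta_k\in\widehat N_\Omega(z_k)$ for all $k$. Limiting coderivative: $D^*K(\bar z,\bar\lambda)(y^* ):=\{x^*\in\mathbb{R}^n\mid(x^*,-y^* )\in N_{\operatorname{gph}K}(\bar z,\bar\lambda)\}$. $K$ is inner semicompact w.r.t. $\operatorname{dom}K$ at $\bar z\in\operatorname{dom}K$ if for each sequence $\{z_k\}\subset\operatorname{dom}K$ with $z_k\to\bar z$ there is a sequence $\{\lambda_k\}$ possessing a bounded subsequence such that $\lambda_k\in K(z_k)$ for all $k$. (This together with closedness of $\operatorname{gph}K$ makes $\operatorname{dom}K$ closed locally around $\bar z$.) A set-valued mapping $\Upsilon$ is metrically subregular at $(\bar x,\bar y)\in\operatorname{gph}\Upsilon$ if there are $\kappa>0$ and a neighborhood $U$ of $\bar x$ such that $\operatorname{dist}(x,\Upsilon^{-1}(\bar y))\le\kappa\operatorname{dist}(\bar y,\Upsilon(x))$ for all $x\in U$, where $\Upsilon^{-1}(\bar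 y)=\{x\mid\bar y\in\Upsilon(x)\}$. Stationarity of $\bar z$: - abstractly M-stationary: $-\nabla f(\bar z)\in N_{M\cap\operatorname{dom}K}(\bar z)$; - implicitly M-stationary: $-\nabla f(\bar z)\in N_M(\bar z)+N_{\operatorname{dom}K}(\bar z)$; - explicitly M-stationary w.r.t. $\bar\lambda\in K(\bar z)$: $-\nabla f(\bar z)\in N_M(\bar z)+D^*K(\bar z,\bar\lambda)(0)$; - explicitly M-stationary: the preceding inclusion holds for all $\bar\lambda\in K(\bar z)$. *)

(* Defs.v *)
From HB Require Import structures.
From mathcomp Require Import all_boot all_order all_algebra.
From mathcomp Require Import all_classical all_reals all_analysis.
Set Implicit Arguments.
Unset Strict Implicit.
Unset Printing Implicit Defensive.
Import Order.TTheory GRing.Theory Num.Theory.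
Import numFieldNormedType.Exports.
Local Open Scope classical_set_scope.
Local Open Scope ring_scope.

(* Vectors of R^n are row vectors 'rV[R]_n; the pair
   (x, y) in R^n x R^m is row_mx x y : 'rV[R]_(n + m). The norm `|_| of
   'rV[R]_n is the max norm, so the Euclidean norm is defined here; both
   induce the same topology. *)

Definition dotp (R : realType) (n : nat) (x y : 'rV[R]_n) : R :=
  \sum_(i < n) x ord0 i * y ord0 i.

Definition enorm (R : realType) (n : nat) (x : 'rV[R]_n) : R :=
  Num.sqrt (dotp x x).

(* Extended-real valued, so that the distance to the empty set is +oo. *)
Definition edist_set (R : realType) (n : nat) (x : 'rV[R]_n)
    (A : set 'rV[R]_n) : \bar R :=
  ereal_inf [set (enorm (x - a))%:E | a in A].

Definition grad (R : realType) (n : nat) (f : 'rV[R]_n -> R) (z : 'rV[R]_n) :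
    'rV[R]_n :=
  \row_(i < n) 'D_(delta_mx ord0 i) f z.

Definition cont_diff (R : realType) (n : nat) (f : 'rV[R]_n -> R) : Prop :=
  (forall z, differentiable f z) /\ continuous (grad f).

Definition gph (R : realType) (n m : nat) (K : 'rV[R]_n -> set 'rV[R]_m) :
    set 'rV[R]_(n + m) :=
  [set w | K (lsubmx w) (rsubmx w)].

Definition dom (R : realType) (n m : nat) (K : 'rV[R]_n -> set 'rV[R]_m) :
    set 'rV[R]_n :=
  [set z | K z !=set0].

Definition msum (R : realType) (n : nat) (A B : set 'rV[R]_n) :
    set 'rV[R]_n :=
  [set a + b | a in A & b in B].

(* Only meaningful at z in Omega; membership is imposed where it is used.
   The remainder r is constrained near z only, so the condition is local. *)
Definition regular_normal_cone (R : realType) (n : nat)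
    (Omega : set 'rV[R]_n) (z : 'rV[R]_n) : set 'rV[R]_n :=
  [set zeta | exists2 r : 'rV[R]_n -> R^o,
     r =o_ z (fun x => enorm (x - z) : R^o) &
     forall x, Omega x -> dotp zeta (x - z) <= r x].

Definition limiting_normal_cone (R : realType) (n : nat)
    (Omega : set 'rV[R]_n) (z : 'rV[R]_n) : set 'rV[R]_n :=
  [set zeta | exists (z_ zeta_ : nat -> 'rV[R]_n),
     [/\ forall k, Omega (z_ k),
         z_ @ \oo --> z,
         zeta_ @ \oo --> zeta &
         forall k, regular_normal_cone Omega (z_ k) (zeta_ k)]].

Definition coderivative (R : realType) (n m : nat)
    (K : 'rV[R]_n -> set 'rV[R]_m) (z : 'rV[R]_n) (l : 'rV[R]_m)
    (ys : 'rV[R]_m) : set 'rV[R]_n :=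
  [set xs | limiting_normal_cone (gph K) (row_mx z l) (row_mx xs (- ys))].

Definition inner_semicompact_dom (R : realType) (n m : nat)
    (K : 'rV[R]_n -> set 'rV[R]_m) (z : 'rV[R]_n) : Prop :=
  forall z_ : nat -> 'rV[R]_n,
    (forall k, dom K (z_ k)) -> z_ @ \oo --> z ->
    exists l_ : nat -> 'rV[R]_m,
      (forall k, K (z_ k) (l_ k)) /\
      exists phi : nat -> nat, increasing_seq phi /\
        exists C : R, forall k, enorm (l_ (phi k)) <= C.

Definition metrically_subregular (R : realType) (n p : nat)
    (Y : 'rV[R]_n -> set 'rV[R]_p) (x0 : 'rV[R]_n) (y0 : 'rV[R]_p) : Prop :=
  Y x0 y0 /\
  exists kappa : R, 0 < kappa /\
    exists U : set 'rV[R]_n, nbhs x0 U /\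
      forall x, U x ->
        (edist_set x [set x' | Y x' y0] <= kappa%:E * edist_set y0 (Y x))%E.

Definition Upsilon_imp (R : realType) (n m : nat) (M : set 'rV[R]_n)
    (K : 'rV[R]_n -> set 'rV[R]_m) (z : 'rV[R]_n) : set 'rV[R]_(n + n) :=
  [set row_mx z z - row_mx a b | a in M & b in dom K].

Definition abstractly_M_stationary (R : realType) (n m : nat)
    (f : 'rV[R]_n -> R) (M : set 'rV[R]_n) (K : 'rV[R]_n -> set 'rV[R]_m)
    (z : 'rV[R]_n) : Prop :=
  limiting_normal_cone (M `&` dom K) z (- grad f z).

Definition implicitly_M_stationary (R : realType) (n m : nat)
    (f : 'rV[R]_n -> R) (M : set 'rV[R]_n) (K : 'rV[R]_n -> set 'rV[R]_m)
    (z : 'rV[R]_n) : Prop :=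
  msum (limiting_normal_cone M z) (limiting_normal_cone (dom K) z)
    (- grad f z).

Definition explicitly_M_stationary_wrt (R : realType) (n m : nat)
    (f : 'rV[R]_n -> R) (M : set 'rV[R]_n) (K : 'rV[R]_n -> set 'rV[R]_m)
    (z : 'rV[R]_n) (l : 'rV[R]_m) : Prop :=
  msum (limiting_normal_cone M z) (coderivative K z l 0) (- grad f z).

Definition explicitly_M_stationary (R : realType) (n m : nat)
    (f : 'rV[R]_n -> R) (M : set 'rV[R]_n) (K : 'rV[R]_n -> set 'rV[R]_m)
    (z : 'rV[R]_n) : Prop :=
  forall l, K z l ->
    msum (limiting_normal_cone M z) (coderivative K z l 0) (- grad f z).

(* Main.v *)
Require Import Defs.
From HB Require Import structures.
From mathcomp Require Import all_boot all_order all_algebra.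
From mathcomp Require Import all_classical all_reals all_analysis.
From mathcomp Require Import ring lra.
Import Order.TTheory GRing.Theory Num.Theory.
Import numFieldNormedType.Exports.
Local Open Scope classical_set_scope.
Local Open Scope ring_scope.

(** The Euclidean norm induces the topology of the space of row vectors, so
regular and limiting normals have epsilon-delta descriptions in that norm
([regular_normalP], [limiting_normalP]); all the arguments use these.

Part (c) is a matter of unfolding.

Part (b): if zeta is a regular normal to dom K at x, then (zeta, 0) is a
regular normal to gph K at (x, l) for every l in K x, because moving along
gph K moves the first component along dom K ([regular_normal_gph]).
Given a limiting normal to dom K at z, inner semicompactness provides bounded
multipliers along the approximating points; they have a cluster point l,
closedness of gph K puts l in K z, and (zeta, 0) is a limiting normal to gph K
at (z, l) ([limiting_normal_dom]).

Part (a) is the inclusion of the limiting normals to an intersection in the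
sum of the limiting normals, for sets A = M and B = dom K such that near z
every a in A lies within a multiple of |a - b| of the intersection, for every
b in B.  This linear regularity is what metric subregularity of Upsilon_imp
says at points of M ([subregular_linear_regularity]).  Closedness of dom K
near z, needed to have minimisers, follows from inner semicompactness and
closedness of gph K ([dom_locally_closed]).

For the inclusion ([limiting_normal_sum]), a regular normal zeta to the
intersection at z means that z minimises e|x - z| - zeta.(x - z) over the
intersection locally.  One decouples x into a in A and b in B and minimises
  (e/s)|a - z|^2 + (j/2)|a - b|^2 - zeta.(a - z)
over pairs (a, b) near z ([fuzzy_normal_sum]).  The objective is quadratic, so
first-order optimality in b and in a gives proximal, hence regular, normals
u = j(a - b) to B at b and zeta - (2e/s)(a - z) - u to A at a.  Linear
regularity turns the local minimality of z into the lower bound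
zeta.(a - z) <= e|a - z| + c|a - b|; comparing with the value 0 at (z, z) and
choosing j = c^2/(2es) forces |a - z| <= 2s and j|a - b| <= 3c
([penalty_estimate]).  Hence the error (2e/s)|a - z| is at most 4e, a and b are
as close to z as desired, and u stays bounded independently of e, so that one
can pass to a cluster point of the u as e tends to 0. *)

(** * Euclidean inner product and norm *)

Section Euclidean.
Set Implicit Arguments.
Unset Strict Implicit.
Unset Printing Implicit Defensive.
Context (R : realType).
Implicit Types n m : nat.

Lemma dotpC n (x y : 'rV[R]_n) : dotp x y = dotp y x.
Proof. by apply: eq_bigr => i _; rewrite mulrC. Qed.

Lemma dotpDl n (x y z : 'rV[R]_n) : dotp (x + y) z = dotp x z + dotp y z.
Proof. by rewrite -big_split; apply: eq_bigr => i _; rewrite mxE mulrDl. Qed.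

Lemma dotpZl n (a : R) (x y : 'rV[R]_n) : dotp (a *: x) y = a * dotp x y.
Proof. by rewrite mulr_sumr; apply: eq_bigr => i _; rewrite mxE mulrA. Qed.

Lemma dotpNl n (x y : 'rV[R]_n) : dotp (- x) y = - dotp x y.
Proof. by rewrite -scaleN1r dotpZl mulN1r. Qed.

Lemma dotpDr n (x y z : 'rV[R]_n) : dotp x (y + z) = dotp x y + dotp x z.
Proof. by rewrite dotpC dotpDl !(dotpC x). Qed.

Lemma dotpZr n (a : R) (x y : 'rV[R]_n) : dotp x (a *: y) = a * dotp x y.
Proof. by rewrite dotpC dotpZl dotpC. Qed.

Lemma dotpNr n (x y : 'rV[R]_n) : dotp x (- y) = - dotp x y.
Proof. by rewrite dotpC dotpNl dotpC. Qed.

Lemma dotp0l n (x : 'rV[R]_n) : dotp 0 x = 0.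
Proof. by rewrite -(scale0r 0) dotpZl mul0r. Qed.

Lemma dotp_ge0 n (x : 'rV[R]_n) : 0 <= dotp x x.
Proof. by apply: sumr_ge0 => i _; rewrite -expr2 sqr_ge0. Qed.

Lemma dotp_row_mx n m (a c : 'rV[R]_n) (b d : 'rV[R]_m) :
  dotp (row_mx a b) (row_mx c d) = dotp a c + dotp b d.
Proof.
by rewrite /dotp big_split_ord; congr (_ + _); apply: eq_bigr => i _;
  rewrite ?row_mxEl ?row_mxEr.
Qed.

Lemma enorm_ge0 n (x : 'rV[R]_n) : 0 <= enorm x.
Proof. exact: sqrtr_ge0. Qed.

Lemma sqr_enorm n (x : 'rV[R]_n) : enorm x ^+ 2 = dotp x x.
Proof. by rewrite sqr_sqrtr ?dotp_ge0. Qed.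

Lemma enormN n (x : 'rV[R]_n) : enorm (- x) = enorm x.
Proof. by rewrite /enorm dotpNl dotpNr opprK. Qed.

Lemma enorm_subC n (x y : 'rV[R]_n) : enorm (x - y) = enorm (y - x).
Proof. by rewrite -enormN opprB. Qed.

Lemma enorm0 n : enorm (0 : 'rV[R]_n) = 0.
Proof. by rewrite /enorm dotp0l sqrtr0. Qed.

Lemma enormZ n (a : R) (x : 'rV[R]_n) : enorm (a *: x) = `|a| * enorm x.
Proof.
by rewrite /enorm dotpZl dotpZr mulrA -expr2 sqrtrM ?sqr_ge0// sqrtr_sqr.
Qed.

Lemma dotp_le_enorm n (x y : 'rV[R]_n) : dotp x y <= enorm x * enorm y.
Proof.
have ex := enorm_ge0 x; have ey := enorm_ge0 y.
apply: le_trans (ler_norm _) _.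
rewrite -(ler_pXn2r (ltn0Sn 1)) ?nnegrE ?mulr_ge0//.
rewrite real_normK ?num_real// exprMn !sqr_enorm.
(* Cauchy-Schwarz through the sign of the polynomial |t x + y|^2 in t. *)
have H t : 0 <= t ^+ 2 * dotp x x + 2 * t * dotp x y + dotp y y.
  have := dotp_ge0 (t *: x + y).
  by rewrite !(dotpDl, dotpDr, dotpZl, dotpZr) (dotpC y x); congr (_ <= _); ring.
have [x0|xN0] := eqVneq (dotp x x) 0.
  have [->|dN0] := eqVneq (dotp x y) 0; first by rewrite x0 expr0n mul0r.
  (* If |x| = 0 the polynomial is affine in t; this t makes it negative. *)
  have := H (- (dotp y y + 1) / dotp x y); rewrite x0 -mulrA divfK//.
  by have := dotp_ge0 y; lra.
have xp : 0 < dotp x x by rewrite lt_def xN0 dotp_ge0.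
have := H (- dotp x y / dotp x x).
rewrite -(pmulr_rge0 _ xp).
suff -> : dotp x x * ((- dotp x y / dotp x x) ^+ 2 * dotp x x +
    2 * (- dotp x y / dotp x x) * dotp x y + dotp y y) =
    dotp x x * dotp y y - dotp x y ^+ 2 by rewrite subr_ge0.
by field.
Qed.

Lemma enormD n (x y : 'rV[R]_n) : enorm (x + y) <= enorm x + enorm y.
Proof.
have ex := enorm_ge0 x; have ey := enorm_ge0 y.
rewrite -(ler_pXn2r (ltn0Sn 1)) ?nnegrE ?addr_ge0 ?enorm_ge0//.
rewrite sqr_enorm sqrrD !sqr_enorm !(dotpDl, dotpDr) (dotpC y x).
have := dotp_le_enorm x y; lra.
Qed.

Lemma enorm_split n (y x z : 'rV[R]_n) :
  enorm (x - z) <= enorm (x - y) + enorm (y - z).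
Proof. by rewrite -(subrKA y); exact: enormD. Qed.

Lemma enorm_row_mx n m (a : 'rV[R]_n) (b : 'rV[R]_m) :
  enorm (row_mx a b) <= enorm a + enorm b.
Proof.
have ea := enorm_ge0 a; have eb := enorm_ge0 b.
rewrite -(ler_pXn2r (ltn0Sn 1)) ?nnegrE ?addr_ge0 ?enorm_ge0//.
rewrite sqr_enorm dotp_row_mx sqrrD !sqr_enorm; nra.
Qed.

Lemma enorm_le_row_mx n m (a : 'rV[R]_n) (b : 'rV[R]_m) :
  enorm a <= enorm (row_mx a b).
Proof. by rewrite ler_wsqrtr// dotp_row_mx lerDl dotp_ge0. Qed.

Lemma normr_le_enorm n (x : 'rV[R]_n) : `|x| <= enorm x.
Proof.
rewrite [leLHS]/Num.norm /= mx_normrE; apply/bigmax_leP; split=> [|[i j] _ /=].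
  exact: enorm_ge0.
rewrite (ord1 i) -sqrtr_sqr ler_wsqrtr// expr2 /dotp (bigD1 j)//= lerDl.
by apply: sumr_ge0 => k _; rewrite -expr2 sqr_ge0.
Qed.

Lemma enorm_le_normr n (x : 'rV[R]_n) : enorm x <= n.+1%:R * `|x|.
Proof.
rewrite -(ler_pXn2r (ltn0Sn 1)) ?nnegrE ?mulr_ge0 ?enorm_ge0//.
rewrite sqr_enorm exprMn.
have le_coord j : `|x ord0 j| <= `|x|.
  rewrite [leRHS]/Num.norm /= mx_normrE.
  by apply/bigmax_geP; right; exists (ord0, j).
apply: (@le_trans _ _ (\sum_(i < n) `|x| ^+ 2)).
  apply: ler_sum => i _; rewrite -expr2 -real_normK ?num_real//.
  by rewrite lerXn2r ?nnegrE.
rewrite sumr_const card_ord -[leLHS]mulr_natl ler_wpM2r ?sqr_ge0//.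
by rewrite -natrX ler_nat expnS expn1 (leq_trans (leqnSn n))// leq_pmulr.
Qed.

End Euclidean.

(** * Euclidean balls and the topology of row vectors *)

Section Cones.
Set Implicit Arguments.
Unset Strict Implicit.
Unset Printing Implicit Defensive.
Context (R : realType).
Implicit Types n m : nat.

(** The topology of row vectors is defined by the max norm, which is equivalent
to the Euclidean one. *)
Lemma nbhs_enormP n (z : 'rV[R]_n) (U : set 'rV[R]_n) :
  nbhs z U <-> exists2 d, 0 < d & forall x, enorm (x - z) < d -> U x.
Proof.
split=> [/nbhs_ballP[d /= d0 dU]|[d d0 dU]].
  exists d => // x xz; apply: dU; rewrite -ball_normE /ball_ /= distrC.
  exact: le_lt_trans (normr_le_enorm _) xz.
have n0 : 0 < n.+1%:R :> R by rewrite ltr0n.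
apply/nbhs_ballP; exists (d / n.+1%:R) => /=; first exact: divr_gt0.
move=> x; rewrite -ball_normE /ball_ /= distrC => xz; apply: dU.
by apply: le_lt_trans (enorm_le_normr _) _; rewrite mulrC -ltr_pdivlMr.
Qed.

Lemma cvg_enormP n (T : Type) (F : set_system T) {FF : Filter F}
    (u : T -> 'rV[R]_n) (l : 'rV[R]_n) :
  u x @[x --> F] --> l <->
  forall e, 0 < e -> \forall x \near F, enorm (u x - l) < e.
Proof.
split=> [ul e e0|H U /nbhs_enormP[d d0 dU]].
  have : nbhs l [set y | enorm (y - l) < e] by apply/nbhs_enormP; exists e.
  exact: ul.
rewrite /nbhs /=; near=> x; apply: dU; near: x; exact: H.
Unshelve. all: by end_near. Qed.

Lemma closed_enorm n (A : set 'rV[R]_n) (p : 'rV[R]_n) : closed A ->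
  (forall e, 0 < e -> exists2 x, A x & enorm (x - p) < e) -> A p.
Proof.
move=> cA H; suff : closure A p by exact: cA.
move=> U /nbhs_enormP[d d0 dU].
by have [x Ax /dU Ux] := H _ d0; exists x.
Qed.

Lemma closed_enorm_ball n (z : 'rV[R]_n) (r : R) :
  closed [set x | enorm (x - z) <= r].
Proof.
move=> p H /=; apply/ler_addgt0Pr => e e0.
have : nbhs p [set x | enorm (x - p) < e] by apply/nbhs_enormP; exists e.
move=> /H[x [/= xz xp]]; have := enorm_split x p z.
rewrite (enorm_subC p x); lra.
Qed.

Lemma compact_enorm_bounded n (A : set 'rV[R]_n) (z : 'rV[R]_n) (r : R) :
  closed A -> (forall x, A x -> enorm (x - z) <= r) -> compact A.
Proof.
move=> cA Ar; apply: bounded_closed_compact => //.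
exists (r + enorm z); split; first exact: num_real.
move=> y ry x /Ar xz; apply: le_trans (normr_le_enorm _) (le_trans _ (ltW ry)).
by have := enormD (x - z) z; rewrite subrK; lra.
Qed.

(** Bolzano-Weierstrass in cluster-point form: this suffices in place of a
convergent subsequence, since limiting normals are approximated one tolerance
at a time. *)
Lemma bounded_seq_cluster n (u : nat -> 'rV[R]_n) (C : R) :
  (forall k, enorm (u k) <= C) ->
  exists p, forall e, 0 < e -> forall N, exists2 k, (N <= k)%N &
    enorm (u k - p) < e.
Proof.
move=> uC.
have cB := compact_enorm_bounded (@closed_enorm_ball n 0 C)
  (fun x (h : enorm (x - 0) <= C) => h).
have [|p [_ pcl]] := cB (u @ \oo) _.
  by exists 0%N => // k _ /=; rewrite subr0.
exists p => e e0 N.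
have [||_ [[k Nk <-] kp]] := pcl (u @` [set k | (N <= k)%N])
  [set x | enorm (x - p) < e].
- by exists N => // k /= Nk; exists k.
- by apply/nbhs_enormP; exists e.
- by exists k.
Qed.

Lemma cvg_dotp n (T : Type) (F : set_system T) {FF : Filter F}
    (u v : T -> 'rV[R]_n) (a b : 'rV[R]_n) :
  u x @[x --> F] --> a -> v x @[x --> F] --> b ->
  dotp (u x) (v x) @[x --> F] --> dotp a b.
Proof.
move=> ua vb; rewrite /dotp.
apply: (@cvg_big R^o _ +%R) => [|i _]; first exact: add_continuous.
by apply: (@cvgM R); apply: (continuous_cvg _ (@coord_continuous _ _ _ _ _ _)).
Qed.

(** * Normal cones *)

Lemma regular_normalP n (Omega : set 'rV[R]_n) (z zeta : 'rV[R]_n) :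
  regular_normal_cone Omega z zeta <->
  forall e, 0 < e -> exists2 d, 0 < d & forall x, Omega x ->
    enorm (x - z) < d -> dotp zeta (x - z) <= e * enorm (x - z).
Proof.
split=> [[r /eqoP ro rle] e e0|H].
  have /nbhs_enormP[d d0 dr] := ro _ e0.
  exists d => // x Ox /dr; rewrite [X in _ <= _ * X]ger0_norm ?enorm_ge0// => xd.
  exact: le_trans (rle _ Ox) (le_trans (ler_norm _) xd).
(* The least admissible remainder: the positive part, and 0 off Omega. *)
pose r x : R^o := if pselect (Omega x) then Num.max 0 (dotp zeta (x - z)) else 0.
exists r; last first.
  by move=> x Ox; rewrite /r; case: pselect => //= Ox'; rewrite le_max lexx orbT.
apply/eqoP => e e0; have [d d0 dz] := H _ e0.
apply/nbhs_enormP; exists d => // x xd /=.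
have xe : 0 <= e * enorm (x - z) by rewrite mulr_ge0 ?enorm_ge0// ltW.
rewrite [X in _ <= _ * X]ger0_norm ?enorm_ge0// /r.
case: pselect => [Ox|nOx] /=; last by rewrite normr0.
by rewrite ger0_norm ?le_max ?lexx// ge_max xe dz.
Qed.

(** Proximal normals are regular: a quadratic remainder is o(|x - z|). *)
Lemma proximal_normal_regular n (Omega : set 'rV[R]_n) (z zeta : 'rV[R]_n)
    (c d : R) : 0 < d ->
  (forall x, Omega x -> enorm (x - z) < d ->
    dotp zeta (x - z) <= c * enorm (x - z) ^+ 2) ->
  regular_normal_cone Omega z zeta.
Proof.
move=> d0 H; apply/regular_normalP => e e0.
have c0 : 0 < `|c| + 1 by have := normr_ge0 c; lra.
exists (Num.min d (e / (`|c| + 1))); first by rewrite lt_min d0 divr_gt0.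
move=> x Ox; rewrite lt_min ltr_pdivlMr// => /andP[xd xe].
apply: le_trans (H _ Ox xd) _; rewrite expr2 mulrA ler_wpM2r ?enorm_ge0//.
by have := enorm_ge0 (x - z); have := ler_norm c; nra.
Qed.

(** A diagonal argument removes the sequences from the limiting cone. *)
Lemma limiting_normalP n (Omega : set 'rV[R]_n) (z zeta : 'rV[R]_n) :
  limiting_normal_cone Omega z zeta <->
  forall e, 0 < e -> exists z' zeta', [/\ Omega z', enorm (z' - z) < e,
    enorm (zeta' - zeta) < e & regular_normal_cone Omega z' zeta'].
Proof.
split=> [[z_ [zeta_ [Oz /cvg_enormP zz /cvg_enormP zetaz reg]]] e e0|H].
  have : \forall k \near \oo, enorm (z_ k - z) < e /\
      enorm (zeta_ k - zeta) < e.
    by near=> k; split; near: k; [exact: zz|exact: zetaz].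
  move=> [N _ /(_ N (leqnn N))[zN zetaN]].
  by exists (z_ N), (zeta_ N); split.
have {}H k : exists p : 'rV[R]_n * 'rV[R]_n, [/\ Omega p.1,
    enorm (p.1 - z) < k.+1%:R^-1, enorm (p.2 - zeta) < k.+1%:R^-1 &
    regular_normal_cone Omega p.1 p.2].
  have [|z' [zeta' ?]] := H k.+1%:R^-1; first by rewrite invr_gt0.
  by exists (z', zeta').
have [p Hp] := choice H.
exists (fst \o p), (snd \o p); split.
- by move=> k; case: (Hp k).
- apply/cvg_enormP => e e0; near=> k; case: (Hp k) => _ pz _ _.
  apply: lt_trans pz _.
  by near: k; exact: (near_infty_natSinv_lt (PosNum e0)).
- apply/cvg_enormP => e e0; near=> k; case: (Hp k) => _ _ pz _.
  apply: lt_trans pz _.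
  by near: k; exact: (near_infty_natSinv_lt (PosNum e0)).
- by move=> k; case: (Hp k).
Unshelve. all: by end_near. Qed.

End Cones.

(** * Limiting normals to an intersection *)

Section SumRule.
Set Implicit Arguments.
Unset Strict Implicit.
Unset Printing Implicit Defensive.
Context (R : realType).
Implicit Types n m : nat.

(** The a priori bounds for the minimiser in [fuzzy_normal_sum], where
t = e / s, j = c^2 / (2 e s), q = |a - z| and S = |a - b|.  By Young's
inequality c S <= (j/2) S^2 + e s, so the hypothesis leaves
q^2 <= s q + s^2; and y = j S satisfies y^2 <= 2 c^2 + 2 c y.  The choice of j
balances the two: j must be large for the Young term to be of order e s, while
e s j must stay bounded for y to be. *)
Lemma penalty_estimate (e s t j c q S : R) :
  0 < e -> 0 < s -> 0 < c -> 0 < j -> 0 <= q -> 0 <= S ->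
  t * s = e -> 2 * e * s * j = c ^+ 2 ->
  t * q ^+ 2 + j / 2 * S ^+ 2 <= e * q + c * S ->
  q <= 2 * s /\ j * S <= 3 * c.
Proof.
move=> e0 s0 c0 j0 q0 S0 ts esj H.
have q2s : q <= 2 * s.
  have Hs : e * q ^+ 2 + j * s / 2 * S ^+ 2 <= e * q * s + c * S * s.
    have := ler_wpM2r (ltW s0) H; rewrite -ts.
    by congr (_ <= _); ring.
  have sq : 0 <= (c * S - 2 * e * s) ^+ 2 by exact: sqr_ge0.
  have young : c * S * s <= j * s / 2 * S ^+ 2 + e * s ^+ 2.
    rewrite -(ler_pM2l (mulr_gt0 (ltr0n R 4) e0)) -subr_ge0.
    suff -> : 4 * e * (j * s / 2 * S ^+ 2 + e * s ^+ 2) - 4 * e * (c * S * s) =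
      (c * S - 2 * e * s) ^+ 2 by [].
    have -> : 4 * e * (j * s / 2 * S ^+ 2 + e * s ^+ 2) =
      2 * e * s * j * S ^+ 2 + 4 * e ^+ 2 * s ^+ 2 by field.
    by rewrite esj; ring.
  have {Hs young} : q ^+ 2 <= q * s + s ^+ 2.
    rewrite -(ler_pM2l e0); lra.
  rewrite leNgt => H2; apply/negP => ?; nra.
split=> //.
have : (j * S) ^+ 2 <= 2 * c ^+ 2 + 2 * c * (j * S).
  have : t * q ^+ 2 >= 0 by rewrite mulr_ge0 ?sqr_ge0// -(pmulr_lge0 _ s0) ts ltW.
  have : e * q <= e * (2 * s) by rewrite ler_pM2l.
  move=> H1 H2.
  have H3 : j / 2 * S ^+ 2 <= 2 * e * s + c * S by lra.
  have := ler_wpM2l (ltW j0) H3; rewrite -esj; nra.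
have : 0 <= j * S by rewrite mulr_ge0// ltW.
move: (j * S) => y y0; rewrite leNgt => H2; apply/negP => ?; nra.
Qed.

Lemma penalty_exists_min n (A B : set 'rV[R]_n) (z zeta : 'rV[R]_n) (t j : R) :
  A z -> B z -> compact A -> compact B ->
  exists a b, [/\ A a, B b & forall a' b', A a' -> B b' ->
    t * dotp (a - z) (a - z) + j * dotp (a - b) (a - b) - dotp zeta (a - z) <=
    t * dotp (a' - z) (a' - z) + j * dotp (a' - b') (a' - b')
      - dotp zeta (a' - z)].
Proof.
move=> Az Bz cA cB.
pose F (p : 'rV[R]_n * 'rV[R]_n) : R := t * dotp (p.1 - z) (p.1 - z) +
  j * dotp (p.1 - p.2) (p.1 - p.2) - dotp zeta (p.1 - z).
have cF : continuous F.
  move=> p.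
  have c1 : (q.1 - z) @[q --> p] --> p.1 - z.
    by apply: cvgB; [exact: cvg_fst|exact: cvg_cst].
  have c2 : (q.1 - q.2) @[q --> p] --> p.1 - p.2.
    by apply: cvgB; [exact: cvg_fst|exact: cvg_snd].
  apply: (@cvgB R R^o); last by apply: cvg_dotp => //; exact: cvg_cst.
  by apply: (@cvgD R R^o); apply: cvgM; (try exact: cvg_cst); apply: cvg_dotp.
have [|//||[a b]] := @compact_EVT_min _ _ F (A `*` B).
- by exists (z, z).
- exact: compact_setX.
- exact: continuous_subspaceT.
rewrite inE => -[/= Aa Bb] abmin; exists a, b; split => // a' b' Aa' Bb'.
by apply: (abmin (a', b')); rewrite inE.
Qed.

Lemma closed_sub_ball n (A : set 'rV[R]_n) (w z : 'rV[R]_n) (r rho : R) :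
  closed (A `&` [set x | enorm (x - w) <= r]) -> enorm (z - w) + rho <= r ->
  closed (A `&` [set x | enorm (x - z) <= rho]).
Proof.
move=> cA zw.
have -> : A `&` [set x | enorm (x - z) <= rho] =
    (A `&` [set x | enorm (x - w) <= r]) `&` [set x | enorm (x - z) <= rho].
  rewrite eqEsubset; split=> [x [Ax xz]|x [[Ax _] xz]]; split=> //; split=> //=.
  by have := enorm_split z x w; move: xz => /=; lra.
by apply: closedI => //; exact: closed_enorm_ball.
Qed.

Lemma compact_sub_ball n (A : set 'rV[R]_n) (w z : 'rV[R]_n) (r rho : R) :
  closed (A `&` [set x | enorm (x - w) <= r]) -> enorm (z - w) + rho <= r ->
  compact (A `&` [set x | enorm (x - z) <= rho]).
Proof.
move=> cA zw; have cAz := closed_sub_ball cA zw.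
by apply: (@compact_enorm_bounded _ _ _ z rho cAz) => x [].
Qed.

(** A regular normal to A `&` B is, up to 4 e, a sum of regular normals to A and
to B at nearby points.  The bound on u is uniform in e and z, which is what
makes the passage to the limit possible. *)
Lemma fuzzy_normal_sum n (A B : set 'rV[R]_n) (w z zeta : 'rV[R]_n)
    (kappa r L e : R) :
  0 < kappa -> 0 < r ->
  closed (A `&` [set x | enorm (x - w) <= r]) ->
  closed (B `&` [set x | enorm (x - w) <= r]) ->
  (forall a b, A a -> B b -> enorm (a - w) < r ->
    exists2 p, (A `&` B) p & enorm (a - p) <= kappa * enorm (a - b)) ->
  (A `&` B) z -> enorm (z - w) < r / 2 ->
  regular_normal_cone (A `&` B) z zeta -> enorm zeta <= L ->
  0 < e -> e <= 1 ->
  exists a b u v, [/\ A a /\ B b, enorm (a - z) < e /\ enorm (b - z) < e,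
    regular_normal_cone A a v /\ regular_normal_cone B b u,
    enorm (zeta - (u + v)) <= 4 * e &
    enorm u <= 3 * (kappa * (1 + L) + 1)].
Proof.
move=> k0 r0 clA clB linreg [Az Bz] zw /regular_normalP regz zetaL e0 e1.
have L0 : 0 <= L by exact: le_trans (enorm_ge0 _) zetaL.
have [d d0 dz] := regz _ e0.
have k1 : 0 < 2 * (1 + 2 * kappa) by lra.
(* In the rho-ball around z, the point p of the intersection provided by linear
   regularity stays in the d-ball where zeta behaves as a normal. *)
pose rho := Num.min (r / 2 * 2^-1) (d / (2 * (1 + 2 * kappa))).
have rho0 : 0 < rho by rewrite lt_min !divr_gt0.
have rho_r : rho <= r / 2 * 2^-1 by rewrite ge_min lexx.
have rho_d : rho * (1 + 2 * kappa) < d.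
  have : rho <= d / (2 * (1 + 2 * kappa)) by rewrite ge_min lexx orbT.
  by rewrite ler_pdivlMr//; nra.
(* The minimiser satisfies |a - z| <= 2 s and |b - z| <= 8 s; with 9 s it lies in
   the interior of the rho-ball, a margin s being left for variations. *)
pose s := Num.min rho e / 9.
have m0 : 0 < Num.min rho e by rewrite lt_min rho0.
have s0 : 0 < s by rewrite divr_gt0.
have s_rho : 9 * s <= rho by rewrite /s mulrC divfK ?pnatr_eq0// ge_min lexx.
have s_e : 9 * s <= e by rewrite /s mulrC divfK ?pnatr_eq0// ge_min lexx orbT.
(* kappa (e + L) is the exact penalty constant; adding 1 gives c >= 1, used to
   bound |a - b| by 6 s. *)
pose c := kappa * (e + L) + 1.
have c1 : 1 <= c by rewrite /c lerDr mulr_ge0//; lra.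
have c0 : 0 < c by lra.
pose t := e / s; pose j := c ^+ 2 / (2 * e * s).
have es0 : 0 < 2 * e * s by rewrite !mulr_gt0.
have t0 : 0 < t by rewrite divr_gt0.
have j0 : 0 < j by rewrite divr_gt0// exprn_gt0.
have ts : t * s = e by rewrite /t divfK// gt_eqF.
have esj : 2 * e * s * j = c ^+ 2 by rewrite /j mulrC divfK// gt_eqF.
have zwr : enorm (z - w) + rho <= r by lra.
have ball_z : enorm (z - z) <= rho by rewrite subrr enorm0 ltW.
have [a [b [[Aa az] [Bb bz] abmin]]] := penalty_exists_min zeta t (j / 2)
  (conj Az ball_z) (conj Bz ball_z) (compact_sub_ball clA zwr)
  (compact_sub_ball clB zwr).
move: az bz => /= az bz.
have [q2s jS3c] : enorm (a - z) <= 2 * s /\ j * enorm (a - b) <= 3 * c.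
  apply: (penalty_estimate e0 s0 c0 j0 (enorm_ge0 _) (enorm_ge0 _) ts esj).
  (* Compare with the pair (z, z), where the objective vanishes. *)
  have := abmin z z (conj Az ball_z) (conj Bz ball_z).
  rewrite !subrr !dotp0l (dotpC zeta 0) dotp0l !mulr0 subr0 addr0 subr_le0.
  rewrite -!sqr_enorm => /le_trans; apply.
  have aw : enorm (a - w) < r by have := enorm_split z a w; lra.
  have [p [Ap Bp] ap] := linreg _ _ Aa Bb aw.
  have ab : enorm (a - b) <= 2 * rho.
    by have := enorm_split z a b; rewrite (enorm_subC z b); lra.
  have pz : enorm (p - z) <= enorm (a - z) + kappa * enorm (a - b).
    by have := enorm_split a p z; rewrite (enorm_subC p a); lra.
  have /(dz _ (conj Ap Bp)) : enorm (p - z) < d by nra.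
  have := dotp_le_enorm zeta (a - p).
  have -> : dotp zeta (a - z) = dotp zeta (p - z) + dotp zeta (a - p).
    by rewrite -dotpDr [in RHS]addrC subrKA.
  have := enorm_ge0 (a - p); have := enorm_ge0 (a - b).
  have := enorm_ge0 (p - z); have := enorm_ge0 zeta.
  rewrite /c => ? ? ? ? H1 H2.
  have H3 : enorm zeta * enorm (a - p) <= L * (kappa * enorm (a - b)).
    exact: ler_pM.
  have H4 : e * enorm (p - z) <=
     e * (enorm (a - z) + kappa * enorm (a - b)) by rewrite ler_pM2l.
  lra.
have S6s : enorm (a - b) <= 6 * s.
  have H : j * enorm (a - b) * (2 * e * s) <= 3 * c * (2 * e * s).
    by rewrite ler_pM2r.
  have {}H : c * (c * enorm (a - b)) <= c * (6 * e * s).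
    have -> : c * (c * enorm (a - b)) = 2 * e * s * j * enorm (a - b).
      by rewrite esj; ring.
    lra.
  move: H; rewrite ler_pM2l// => H.
  have := enorm_ge0 (a - b); nra.
have bz8 : enorm (b - z) <= 8 * s.
  by have := enorm_split a b z; rewrite (enorm_subC b a); lra.
exists a, b, (j *: (a - b)), (zeta - (2 * t) *: (a - z) - j *: (a - b)).
split=> //; first by split; lra.
- split.
  (* Optimality in a, then in b, the other variable being fixed; expanding the
     squares leaves a quadratic remainder. *)
  + apply: (@proximal_normal_regular _ _ _ _ _ (t + j / 2) s) => // x Ax xa.
    have xz : enorm (x - z) <= rho by have := enorm_split a x z; lra.
    have := abmin x b (conj Ax xz) (conj Bb bz).
    have -> : x - z = (x - a) + (a - z) by rewrite subrKA.
    have -> : x - b = (x - a) + (a - b) by rewrite subrKA.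
    rewrite sqr_enorm; move: (x - a) (a - z) (a - b) => h p q.
    rewrite !(dotpDl, dotpDr, dotpNl, dotpNr, dotpZl, dotpZr).
    rewrite (dotpC p h) (dotpC q h); lra.
  + apply: (@proximal_normal_regular _ _ _ _ _ (j / 2) s) => // x Bx xb.
    have xz : enorm (x - z) <= rho by have := enorm_split b x z; lra.
    have := abmin a x (conj Aa az) (conj Bx xz).
    have -> : a - x = (a - b) - (x - b) by apply/rowP => i; rewrite !mxE; ring.
    rewrite sqr_enorm; move: (x - b) (a - z) (a - b) => h p q.
    rewrite !(dotpDl, dotpDr, dotpNl, dotpNr, dotpZl, dotpZr).
    rewrite (dotpC q h); lra.
- have -> : zeta - (j *: (a - b) + (zeta - (2 * t) *: (a - z) - j *: (a - b)))
      = (2 * t) *: (a - z).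
    by apply/rowP => i; rewrite !mxE; ring.
  have t20 : 0 <= 2 * t by lra.
  rewrite enormZ ger0_norm//.
  by have := ler_wpM2l (ltW t0) q2s; lra.
- rewrite enormZ ger0_norm ?(ltW j0)//; apply: le_trans jS3c _.
  rewrite ler_pM2l// /c lerD2r ler_pM2l//; lra.
Qed.

(** The exact sum rule: the summands u of [fuzzy_normal_sum] are bounded along
e -> 0, and a cluster point of them splits zeta. *)
Lemma limiting_normal_sum n (A B : set 'rV[R]_n) (w : 'rV[R]_n) (kappa r : R) :
  0 < kappa -> 0 < r ->
  closed (A `&` [set x | enorm (x - w) <= r]) ->
  closed (B `&` [set x | enorm (x - w) <= r]) ->
  (forall a b, A a -> B b -> enorm (a - w) < r ->
    exists2 p, (A `&` B) p & enorm (a - p) <= kappa * enorm (a - b)) ->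
  limiting_normal_cone (A `&` B) w `<=`
    Defs.msum (limiting_normal_cone A w) (limiting_normal_cone B w).
Proof.
move=> k0 r0 clA clB linreg zeta /limiting_normalP zetaN.
pose L := enorm zeta + 1; pose C := 3 * (kappa * (1 + L) + 1).
pose eps (k : nat) : R := k.+1%:R^-1.
have approx k : exists p : ('rV[R]_n * 'rV[R]_n) * ('rV[R]_n * 'rV[R]_n),
    [/\ A p.1.1 /\ B p.1.2, enorm (p.1.1 - w) <= 5 * eps k /\
      enorm (p.1.2 - w) <= 5 * eps k,
    regular_normal_cone A p.1.1 p.2.2 /\ regular_normal_cone B p.1.2 p.2.1,
    enorm (zeta - (p.2.1 + p.2.2)) <= 5 * eps k &
    enorm p.2.1 <= C].
  have e0 : 0 < eps k by rewrite invr_gt0.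
  have e1 : eps k <= 1 by rewrite invf_le1 ?ltr0n// ler1n.
  have [|z [zeta' [ABz zw zeta'z reg]]] := zetaN (Num.min (eps k) (r / 2)).
    by rewrite lt_min e0 divr_gt0.
  move: zw zeta'z; rewrite !lt_min => /andP[zwe zwr] /andP[zee zer].
  have zeta'L : enorm zeta' <= L.
    by have := enormD (zeta' - zeta) zeta; rewrite subrK /L; lra.
  have [a [b [u [v [ABab [az bz] reguv uv uC]]]]] :=
    fuzzy_normal_sum k0 r0 clA clB linreg ABz zwr reg zeta'L e0 e1.
  exists ((a, b), (u, v)); split => //=.
  - by have := enorm_split z a w; have := enorm_split z b w; split; lra.
  - have := enorm_split zeta' zeta (u + v).
    by rewrite (enorm_subC zeta zeta'); lra.
have [p Hp] := choice approx.
have [u ucl] : exists u, forall e, 0 < e -> forall N, exists2 k, (N <= k)%N &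
    enorm ((p k).2.1 - u) < e.
  by apply: (@bounded_seq_cluster _ _ _ C) => k; case: (Hp k).
have pick e : 0 < e -> exists2 k, 5 * eps k < e & enorm ((p k).2.1 - u) < e.
  move=> e0.
  have [N _ HN] := near_infty_natSinv_lt (PosNum (divr_gt0 e0 (ltr0n R 5))).
  have [k Nk ku] := ucl _ e0 N; exists k => //.
  by have := HN _ Nk; rewrite /= ltr_pdivlMr// mulrC.
exists (zeta - u); last (exists u; last by rewrite subrK); apply/limiting_normalP => e e0.
- have e20 : 0 < e / 2 by rewrite divr_gt0.
  have [k ke ku] := pick _ e20.
  case: (Hp k) => -[Aa Bb] [aw bw] [rA rB] uv _.
  exists (p k).1.1, (p k).2.2; split => //; first by lra.
  have -> : (p k).2.2 - (zeta - u) =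
      - (zeta - ((p k).2.1 + (p k).2.2)) - ((p k).2.1 - u).
    by apply/rowP => i; rewrite !mxE; ring.
  apply: le_lt_trans (enormD _ _) _; rewrite !enormN; lra.
- have [k ke ku] := pick _ e0.
  case: (Hp k) => -[Aa Bb] [aw bw] [rA rB] uv _.
  by exists (p k).1.2, (p k).2.1; split => //; lra.
Qed.

End SumRule.

(** * Constraint maps with closed graph *)

Section Constraint.
Set Implicit Arguments.
Unset Strict Implicit.
Unset Printing Implicit Defensive.
Context (R : realType) (n m : nat).
Implicit Types (K : 'rV[R]_n -> set 'rV[R]_m) (M : set 'rV[R]_n).

Lemma closed_gph_cluster K (z_ : nat -> 'rV[R]_n) (l_ : nat -> 'rV[R]_m) z l :
  closed (gph K) -> (forall k, K (z_ k) (l_ k)) -> z_ k @[k --> \oo] --> z ->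
  (forall e, 0 < e -> forall N, exists2 k, (N <= k)%N & enorm (l_ k - l) < e) ->
  K z l.
Proof.
move=> cK Kzl /cvg_enormP zz lcl.
suff : gph K (row_mx z l) by rewrite /gph /= row_mxKl row_mxKr.
apply: closed_enorm cK _ => e e0.
have e20 : 0 < e / 2 by rewrite divr_gt0.
have [N _ HN] := zz _ e20; have [k Nk kl] := lcl _ e20 N.
exists (row_mx (z_ k) (l_ k)); first by rewrite /gph /= row_mxKl row_mxKr.
rewrite opp_row_mx add_row_mx; apply: le_lt_trans (enorm_row_mx _ _) _.
have := HN _ Nk; rewrite /=; lra.
Qed.

Lemma increasing_seq_ge (phi : nat -> nat) : increasing_seq phi ->
  forall k, (k <= phi k)%N.
Proof.
move=> incr; elim=> [//|k IH]; apply: leq_ltn_trans IH _.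
by rewrite ltnNge -leEnat incr ltnn.
Qed.

(** The sequential definition gives a uniform local bound: otherwise some
x_k -> z in dom K would have K x_k outside the ball of radius k, so that no
selection would have a bounded subsequence. *)
Lemma inner_semicompact_bounded K z : inner_semicompact_dom K z ->
  exists r C, 0 < r /\ forall x, dom K x -> enorm (x - z) < r ->
    exists2 l, K x l & enorm l <= C.
Proof.
move=> isc; apply: contrapT => nex.
have far k : exists x, [/\ dom K x, enorm (x - z) < k.+1%:R^-1 &
    forall l, K x l -> k%:R < enorm l].
  apply: contrapT => nx; apply: nex; exists k.+1%:R^-1, k%:R.
  split; first by rewrite invr_gt0.
  move=> x Dx xz; apply: contrapT => nl; apply: nx; exists x; split => // l Kl.
  by rewrite ltNge; apply/negP => lk; apply: nl; exists l.
have [x_ Hx] := choice far.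
have Dx k : dom K (x_ k) by case: (Hx k).
have xz : x_ k @[k --> \oo] --> z.
  apply/cvg_enormP => e e0; near=> k; case: (Hx k) => _ kz _.
  apply: lt_trans kz _.
  by near: k; exact: (near_infty_natSinv_lt (PosNum e0)).
have [l_ [Kl [phi [/increasing_seq_ge phi_ge [C lC]]]]] := isc _ Dx xz.
pose k := (Num.truncn C).+1.
have Ck : C <= k%:R by rewrite ltW// truncnS_gt.
have [_ _ /(_ _ (Kl (phi k)))] := Hx (phi k).
apply/negP; rewrite -leNgt (le_trans (lC k))// (le_trans Ck)//.
by rewrite ler_nat.
Unshelve. all: by end_near. Qed.

Lemma dom_locally_closed K z : closed (gph K) -> inner_semicompact_dom K z ->
  exists2 r, 0 < r & closed (dom K `&` [set x | enorm (x - z) <= r]).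
Proof.
move=> cK /inner_semicompact_bounded[r [C [r0 HC]]].
exists (r / 2); first by rewrite divr_gt0.
move=> p pcl.
have pz : enorm (p - z) <= r / 2.
  apply: (@closed_enorm_ball R n z (r / 2)) => U /pcl[x [[_ xz] Ux]].
  by exists x.
split=> //.
have near_p k : exists q : 'rV[R]_n * 'rV[R]_m, [/\ K q.1 q.2,
    enorm (q.1 - p) < k.+1%:R^-1 & enorm q.2 <= C].
  have k0 : 0 < k.+1%:R^-1 :> R by rewrite invr_gt0.
  have /pcl[x [[/= Dx xz] /= xp]] : nbhs p [set x | enorm (x - p) < k.+1%:R^-1].
    by apply/nbhs_enormP; exists k.+1%:R^-1.
  have [|l Kxl lC] := HC _ Dx; first by lra.
  by exists (x, l).
have [q Hq] := choice near_p.
have [l lcl] : exists l, forall e, 0 < e -> forall N, exists2 k, (N <= k)%N &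
    enorm ((q k).2 - l) < e.
  by apply: (@bounded_seq_cluster _ _ _ C) => k; case: (Hq k).
exists l.
apply: (closed_gph_cluster (z_ := fst \o q) (l_ := snd \o q) cK) => //.
  by move=> k; case: (Hq k).
apply/cvg_enormP => e e0; near=> k; case: (Hq k) => _ kz _.
apply: lt_trans kz _.
by near: k; exact: (near_infty_natSinv_lt (PosNum e0)).
Unshelve. all: by end_near. Qed.

Lemma regular_normal_gph K z l zeta : regular_normal_cone (dom K) z zeta ->
  regular_normal_cone (gph K) (row_mx z l) (row_mx zeta 0).
Proof.
move=> /regular_normalP reg; apply/regular_normalP => e e0.
have [d d0 dz] := reg _ e0; exists d => // w Kw.
have -> : w - row_mx z l = row_mx (lsubmx w - z) (rsubmx w - l).
  by rewrite -[w in LHS]hsubmxK opp_row_mx add_row_mx.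
move=> wd; rewrite dotp_row_mx dotp0l addr0.
have le_w := enorm_le_row_mx (lsubmx w - z) (rsubmx w - l).
have Dw : dom K (lsubmx w) by exists (rsubmx w).
apply: le_trans (dz _ Dw (le_lt_trans le_w wd)) _.
by rewrite ler_pM2l.
Qed.

Lemma limiting_normal_dom K z zeta : closed (gph K) ->
  inner_semicompact_dom K z -> limiting_normal_cone (dom K) z zeta ->
  exists2 l, K z l & coderivative K z l 0 zeta.
Proof.
move=> cK /inner_semicompact_bounded[r [C [r0 HC]]] /limiting_normalP zetaN.
pose eps (k : nat) : R := k.+1%:R^-1.
have near_z k : exists q : ('rV[R]_n * 'rV[R]_m) * 'rV[R]_n,
    [/\ K q.1.1 q.1.2, enorm (q.1.1 - z) < eps k, enorm q.1.2 <= C,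
        enorm (q.2 - zeta) < eps k &
        regular_normal_cone (dom K) q.1.1 q.2].
  have [|x [xi [Dx]]] := zetaN (Num.min (eps k) r).
    by rewrite lt_min invr_gt0 ltr0n.
  rewrite !lt_min => /andP[xz xr] /andP[xik _] reg.
  have [l Kxl lC] := HC _ Dx xr.
  by exists ((x, l), xi).
have [q Hq] := choice near_z.
have small (e : R) : 0 < e -> exists N, forall k, (N <= k)%N -> eps k < e.
  by move=> e0; have [N _ HN] := near_infty_natSinv_lt (PosNum e0); exists N.
have [l lcl] : exists l, forall e, 0 < e -> forall N, exists2 k, (N <= k)%N &
    enorm ((q k).1.2 - l) < e.
  by apply: (@bounded_seq_cluster _ _ _ C) => k; case: (Hq k).
exists l.
  apply: (closed_gph_cluster (z_ := fun k => (q k).1.1)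
    (l_ := fun k => (q k).1.2) cK) => //.
    by move=> k; case: (Hq k).
  apply/cvg_enormP => e /small[N HN]; exists N => // k /= /HN.
  by apply: lt_trans; case: (Hq k).
rewrite /coderivative /= oppr0; apply/limiting_normalP => e e0.
have [|N HN] := small (e / 2); first by rewrite divr_gt0.
have [|k Nk kl] := lcl (e / 2) _ N; first by rewrite divr_gt0.
have {}HN := HN _ Nk.
case: (Hq k) => Kq qz _ qzeta reg.
exists (row_mx (q k).1.1 (q k).1.2), (row_mx (q k).2 0); split.
- by rewrite /gph /= row_mxKl row_mxKr.
- rewrite opp_row_mx add_row_mx; apply: le_lt_trans (enorm_row_mx _ _) _; lra.
- rewrite opp_row_mx add_row_mx subrr.
  apply: le_lt_trans (enorm_row_mx _ _) _; rewrite enorm0; lra.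
- exact: regular_normal_gph.
Qed.

(** Evaluate subregularity at a point a of M: the zero set of Upsilon_imp is
M `&` dom K, and (a, a) - (a, b) = (0, a - b) shows that the distance of 0 to
Upsilon_imp a is at most |a - b|.  Doubling kappa makes up for the infimum
defining the distance not being attained. *)
Lemma subregular_linear_regularity M K z :
  metrically_subregular (Upsilon_imp M K) z (row_mx 0 0) ->
  exists kappa r, [/\ 0 < kappa, 0 < r &
    forall a b, M a -> dom K b -> enorm (a - z) < r ->
    exists2 p, (M `&` dom K) p & enorm (a - p) <= kappa * enorm (a - b)].
Proof.
move=> [_ [kappa [k0 [U [/nbhs_enormP[r r0 rU] sub]]]]].
exists (2 * kappa), r; split => //; first by rewrite mulr_gt0.
move=> a b Ma Db /rU/sub dist_le.
have [ab|aNb] := eqVneq a b.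
  by exists a; [split; rewrite // ab|rewrite -ab subrr enorm0 mulr0].
have ab0 : 0 < enorm (a - b).
  rewrite lt_def enorm_ge0 andbT; apply: contra aNb => /eqP ab.
  rewrite -subr_eq0 -normr_le0 -[leRHS]ab; exact: normr_le_enorm.
have : (edist_set a [set x | Upsilon_imp M K x (row_mx 0 0)] <
    (2 * kappa * enorm (a - b))%:E)%E.
  apply: (le_lt_trans dist_le).
  apply: (@le_lt_trans _ _ (kappa%:E * (enorm (a - b))%:E)%E).
    rewrite lee_pmul2l// ereal_inf_lbound//=.
    exists (row_mx a a - row_mx a b); first by exists a => //; exists b.
    rewrite opp_row_mx !add_row_mx subrr opp_row_mx add_row_mx subr0 sub0r.
    by rewrite /enorm dotp_row_mx dotp0l add0r -/(enorm _) enormN.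
  by rewrite -EFinM lte_fin; nra.
move=> /ereal_inf_lt[_ [p [a' Ma' [b' Db']]] + <-]; rewrite lte_fin => E ap.
move: E; rewrite opp_row_mx add_row_mx => /eq_row_mx[/eqP + /eqP].
rewrite !subr_eq0 => /eqP pa' /eqP pb'.
by exists p; [split; [rewrite pa'|rewrite pb']|exact: ltW].
Qed.

End Constraint.

(** * Stationarity *)

Theorem theorem4p15 (R : realType) (n m : nat)
  (f : 'rV[R]_n -> R) (M : set 'rV[R]_n) (K : 'rV[R]_n -> set 'rV[R]_m)
  (zbar : 'rV[R]_n)
  (hf : cont_diff f)
  (hM : closed M)
  (hK : closed (gph K))
  (hz : (M `&` dom K) zbar)
  (hisc : inner_semicompact_dom K zbar) :
  [/\ abstractly_M_stationary f M K zbar ->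
      metrically_subregular (Upsilon_imp M K) zbar (row_mx 0 0) ->
      implicitly_M_stationary f M K zbar,
      implicitly_M_stationary f M K zbar ->
      exists2 lbar, K zbar lbar & explicitly_M_stationary_wrt f M K zbar lbar
    & explicitly_M_stationary f M K zbar <->
      (forall lbar, K zbar lbar -> explicitly_M_stationary_wrt f M K zbar lbar)].
Proof.
split=> [absM sub|[u uM [v vD uv]]|//].
- have [kappa [r [k0 r0 linreg]]] := subregular_linear_regularity sub.
  have [r' r'0 clD] := dom_locally_closed hK hisc.
  pose rho := Num.min r r'.
  have rho0 : 0 < rho by rewrite lt_min r0.
  have rho_r : rho <= r by rewrite ge_min lexx.
  have rho_r' : rho <= r' by rewrite ge_min lexx orbT.
  apply: (limiting_normal_sum k0 rho0) absM.
  + by apply: closedI => //; exact: closed_enorm_ball.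
  + by apply: closed_sub_ball clD _; rewrite subrr enorm0 add0r.
  + move=> a b Ma Db az; apply: linreg => //; exact: lt_le_trans rho_r.
- have [l Kl vl] := limiting_normal_dom hK hisc vD.
  by exists l => //; exists u => //; exists v.
Qed.
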